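(* Let $\mathbf u$ be a recurrent aperiodic quasi-Sturmian infinite word whose language is closed under reversal. Then $$\operatorname{Pal}_{\mathbf u}(n)+\operatorname{Pal}_{\mathbf u}(n+1)=3$$ for every sufficiently large $n$. Consequently, $D(\mathbf u)<\infty$.
   Context: Infinite words are one-sided, over a finite alphabet. A factor of $\mathbf u$ is a contiguous finite block (including the empty word); the language $\mathcal L(\mathbf u)$ is the set of factors. The reversal of $w=w_1\cdots w_r$ is $\overline w=w_r\cdots w_1$; $w$ is a palindrome if $w=\overline w$; the language is closed under reversal if it contains $\overline w$ whenever it contains $w$. The word $\mathbf u$ is recurrent if every factor occurs infinitely often, and aperiodic if it is not of the form $xyyy\cdots$ with $x,y$ finite words and $y$ nonempty. $p_{\mathbf u}(n)$ is the number of factors of length $n$, and $\operatorname{Pal}_{\mathbf u}(n)$ the number of palindromic factors of length $n$. An aperiodic word $\mathbf u$ is quasi-Sturmian if there are constants $d$ and $n_0$ such that $p_{\mathbf u}(n)=n+d$ for all $n\ge n_0$. The palindromic defect of a finite word $w$ is $$D(w)=|w|+1-\#\{\text{distinct palindromic factors of } w\},$$ where the empty word is counted as a palindromic factor, and $D(\mathbf u)=\sup\{D(w):w\in\mathcal L(\mathbf u)\}\in[0,+\infty]$. *)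

(* Defs.v *)
From mathcomp Require Import all_boot all_order all_algebra.
From mathcomp Require Import boolp classical_sets constructive_ereal reals ereal.

Set Implicit Arguments.
Unset Strict Implicit.
Unset Printing Implicit Defensive.

Import Order.TTheory GRing.Theory Num.Theory.

Section InfiniteWords.
Variable A : finType.
Implicit Types (u : nat -> A) (v w x y : seq A).

Definition block u (i n : nat) : seq A := [seq u k | k <- iota i n].

Definition occurs_at u w (i : nat) : Prop := block u i (size w) = w.

Definition language u : set (seq A) := [set w | exists i, occurs_at u w i]%classic.

Definition palindrome w : bool := w == rev w.

Definition closed_under_reversal u : Prop :=
  forall w, language u w -> language u (rev w).

(* Infinitely many occurrences are expressed as arbitrarily late ones. *)
Definition recurrent u : Prop :=
  forall w, language u w -> forall N, exists2 i, N <= i & occurs_at u w i.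

(* u = xyyy... is expressed by comparing u with x y^n on the prefix of length
   |x y^n|, for every n. *)
Definition aperiodic u : Prop :=
  ~ exists x y, y <> [::] /\
      forall n, let z := x ++ flatten (nseq n y) in block u 0 (size z) = z.

Definition factor_complexity u (n : nat) : nat :=
  #|[set w : n.-tuple A | `[< language u w >]]|.

Definition palindromic_complexity u (n : nat) : nat :=
  #|[set w : n.-tuple A | `[< language u w >] && palindrome w]|.

Definition quasi_sturmian u : Prop :=
  aperiodic u /\
  exists (d : int) (n0 : nat), forall n, n0 <= n ->
    ((factor_complexity u n)%:Z = n%:Z + d)%R.

(* Factors of w have length at most |w|, so they are counted inside the finite
   type of words of length at most |w|. *)
Definition word_defect w : int :=
  ((size w).+1%:Z -
     #|[set v : (size w).-bseq A | infix v w && palindrome v]|%:Z)%R.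

Definition defect (R : realType) u : \bar R :=
  ereal_sup [set ((word_defect w)%:~R%R)%:E | w in language u]%classic.

End InfiniteWords.

(* Main.v *)
Require Import Defs.
From mathcomp Require Import all_boot all_order all_algebra zify.
From mathcomp Require Import boolp classical_sets constructive_ereal reals ereal.

Set Implicit Arguments.
Unset Strict Implicit.
Unset Printing Implicit Defensive.

Import Order.TTheory GRing.Theory Num.Theory.

(** Once p(n+1) = p(n) + 1, exactly one factor of each length n is right
    special (followed by more than one letter), and it is followed by exactly
    two letters.  Everything rests on three consequences of this, all stated
    for lengths at or above the threshold N.

    Frames (frame_ex).  Follow a factor s to the right for as long as the next
    letter is forced; aperiodicity makes this stop at a right special word.
    Doing the same for its reversal, and using that the right special word of
    each length is unique, gives W = y s z which is a palindrome, right special,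
    and occurs around every occurrence of s.  If two occurrences of W were at
    distance at most |y| or |z|, then W would force a copy of itself at that
    distance, and u would be eventually periodic (frame_overlap).

    Palindromic returns (return_palindrome).  Let W be a right special
    palindrome with right letters a and b.  The factor stretching from one
    occurrence of W to the next is determined by the letter after its first W.
    If it begins with Wa and ends with aW, its reversal begins with Wa as well,
    so it is a palindrome.  If it began with Wa and ended with bW, then bWb
    would be a factor, since otherwise every Wa would lead to another Wa and u
    would be periodic; applying this to the reversed return, aWa would be a
    factor too.  The right special word of length |W| + 1 is aW or bW, so aWb
    or bWa is a factor, hence both are, and aW and bW are both right special,
    against uniqueness.

    Palindromic extensions (palindromic_extension).  By the same counting of
    the words xWy, every palindrome v has exactly one extension x v x in the
    language.

    For the counting identity, fix a right special palindrome W longer than n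
    and consider W together with its two palindromic returns.  Trimming these
    three cores symmetrically gives palindromes of length n or n + 1 according
    to the parity of their lengths.  Different cores give different palindromes
    by uniqueness of palindromic extensions, and every palindrome is obtained:
    it sits centrally in a palindrome containing W, and the occurrences of W
    closest to the center cut out a core.  So Pal(n) + Pal(n+1) = 3.

    For the defect, frames and palindromic returns show that the factor from
    an occurrence of s to the next occurrence of s or of its reversal is a
    palindrome (twin_return).  Hence if a prefix of w has a longest palindromic
    suffix of length at least N, this suffix is new in that prefix; and a
    prefix of length at least N whose longest palindromic suffix is shorter
    than N ends with the first occurrence of a factor of length N.  So all but
    at most N + |A|^N prefixes of w contribute a new palindrome. *)

(** * Blocks of an infinite word *)

(** Factors are handled through their positions: [same i j n] says that the
    blocks of length [n] at [i] and [j] are equal, [mirror i j n] that they are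
    reversals of each other, and palindromes are the diagonal case of the
    latter.  Passing to subblocks then becomes linear arithmetic. *)
Section Positions.
Variables (A : finType) (u : nat -> A).

Definition same i j n := forall k, k < n -> u (i + k) = u (j + k).

Definition mirror i j n := forall k, k < n -> u (i + k) = u (j + (n - k.+1)).

Definition right_special i n := exists2 j, same i j n & u (i + n) <> u (j + n).

Lemma same_at i j n x y :
  same i j n -> i <= x -> x < i + n -> x + j = y + i -> u x = u y.
Proof.
move=> S ix xn e; have := S (x - i).
have -> : i + (x - i) = x by lia.
have -> : j + (x - i) = y by lia.
by apply; lia.
Qed.

Lemma mirror_at i j n x y :
  mirror i j n -> i <= x -> x < i + n -> x + y + 1 = i + j + n -> u x = u y.
Proof.
move=> S ix xn e; have := S (x - i).
have -> : i + (x - i) = x by lia.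
have -> : j + (n - (x - i).+1) = y by lia.
by apply; lia.
Qed.

Lemma same_sub i j n i' j' n' :
  same i j n -> i <= i' -> i' + n' <= i + n -> i' + j = j' + i ->
  same i' j' n'.
Proof. by move=> S h1 h2 h3 k kn; apply: (same_at S); lia. Qed.

Lemma mirror_sub i j n i' j' n' :
  mirror i j n -> i <= i' -> i' + n' <= i + n -> i' + j' + n' = i + j + n ->
  mirror i' j' n'.
Proof. by move=> S h1 h2 h3 k kn; apply: (mirror_at S); lia. Qed.

Lemma same_refl i n : same i i n.
Proof. by []. Qed.

Lemma same_sym i j n : same i j n -> same j i n.
Proof. by move=> S k kn; rewrite S. Qed.

Lemma same_trans j i k n : same i j n -> same j k n -> same i k n.
Proof. by move=> S S' t tn; rewrite S ?S'. Qed.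

Lemma mirror_sym i j n : mirror i j n -> mirror j i n.
Proof. by move=> S k kn; symmetry; apply: (mirror_at S); lia. Qed.

Lemma same_mirror j i k n : same i j n -> mirror j k n -> mirror i k n.
Proof. by move=> S S' t tn; rewrite S ?S'. Qed.

Lemma mirror_same j i k n : mirror i j n -> same j k n -> mirror i k n.
Proof. by move=> S S' t tn; rewrite S // S' //; lia. Qed.

Lemma mirror_mirror j i k n : mirror i j n -> mirror j k n -> same i k n.
Proof.
move=> S S' t tn; rewrite S // S'; last lia.
by congr u; lia.
Qed.

Lemma same_succ i j n : same i j n -> u (i + n) = u (j + n) -> same i j n.+1.
Proof.
move=> S e k; rewrite ltnS leq_eqVlt => /orP[/eqP->|] //; exact: S.
Qed.

Lemma right_special_suffix i k n :
  right_special i (k + n) -> right_special (i + k) n.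
Proof.
case=> j S ne; exists (j + k); first by apply: (same_sub S); lia.
by rewrite -!addnA.
Qed.

Lemma block_sameP i j n : block u i n = block u j n <-> same i j n.
Proof.
split=> [e k kn|S]; last first.
  apply: (@eq_from_nth _ (u 0)); rewrite !size_map !size_iota // => k kn.
  by rewrite !(nth_map 0) ?size_iota // !nth_iota // S.
have := congr1 (fun s => nth (u 0) s k) e.
by rewrite !(nth_map 0) ?size_iota // !nth_iota.
Qed.

Lemma size_block i n : size (block u i n) = n.
Proof. by rewrite size_map size_iota. Qed.

Lemma nth_block x0 i n k : k < n -> nth x0 (block u i n) k = u (i + k).
Proof. by move=> kn; rewrite (nth_map 0) ?size_iota // nth_iota. Qed.

Lemma block_mirrorP i j n : block u i n = rev (block u j n) <-> mirror i j n.
Proof.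
split=> [e k kn|S]; last first.
  apply: (@eq_from_nth _ (u 0)); rewrite ?size_rev !size_block // => k kn.
  by rewrite nth_rev ?size_block // !nth_block ?S //; lia.
have := congr1 (fun s => nth (u 0) s k) e.
by rewrite /= nth_rev ?size_block // !nth_block //; lia.
Qed.

Lemma language_block i n : language u (block u i n).
Proof. by exists i; rewrite /occurs_at size_block. Qed.

Lemma language_blockP w : language u w -> exists i, w = block u i (size w).
Proof. by case=> i <-; exists i; rewrite size_block. Qed.

Lemma block_palindrome i n : palindrome (block u i n) <-> mirror i i n.
Proof. by rewrite /palindrome -block_mirrorP; split=> [/eqP|/eqP]. Qed.

End Positions.

(** * Consequences of the complexity of the word *)

Section Translation.
Variables (A : finType) (u : nat -> A).

Lemma block_succ i n : block u i n.+1 = rcons (block u i n) (u (i + n)).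
Proof. by rewrite /block -addn1 iotaD map_cat cats1. Qed.

Lemma recurrent_same : recurrent u ->
  forall i n B, exists2 j, B <= j & same u i j n.
Proof.
move=> rec i n B; have [j Bj ij] := rec _ (language_block u i n) B.
exists j => //; apply/block_sameP.
by rewrite /occurs_at size_block in ij.
Qed.

Lemma reversal_mirror : recurrent u -> closed_under_reversal u ->
  forall i n B, exists2 j, B <= j & mirror u i j n.
Proof.
move=> rec rev_u i n B.
have [j Bj ij] := rec _ (rev_u _ (language_block u i n)) B.
exists j => //; apply: mirror_sym; apply/block_mirrorP.
by rewrite /occurs_at size_rev size_block in ij.
Qed.

Lemma aperiodic_shift : aperiodic u ->
  forall p d, 0 < d -> ~ (forall q, p <= q -> u (q + d) = u q).
Proof.
move=> ap p d d0 per; apply: ap; exists (block u 0 p), (block u p d).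
split=> [/(congr1 size)|n]; first by rewrite size_block => d00; rewrite d00 in d0.
have -> : flatten (nseq n (block u p d)) = block u p (n * d).
  elim: n => [//|n IH] /=; rewrite IH mulSn [RHS]/block iotaD map_cat; congr cat.
  by apply/block_sameP => k _; rewrite addnAC per // leq_addr.
rewrite /= size_cat !size_block.
by rewrite [LHS]/block iotaD map_cat.
Qed.

(** Choose one extension letter [h v] for each factor [v].  The words [v h(v)]
    make up p(n) of the p(n) + 1 factors of length n + 1, so that a single
    factor of that length, found at position [z], escapes the choice. *)
Lemma one_extra_extension n : recurrent u ->
  factor_complexity u n.+1 = (factor_complexity u n).+1 ->
  exists (h : seq A -> A) (z : nat), [/\ u (z + n) <> h (block u z n),
    forall i, u (i + n) <> h (block u i n) -> same u i z n.+1 &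
    forall i, exists2 j, same u i j n & u (j + n) = h (block u i n)].
Proof.
move=> rec pn.
have ext v : exists a, language u v -> language u (rcons v a).
  have [[i iv]|nv] := EM (language u v); last by exists (u 0).
  by exists (u (i + size v)) => _; rewrite -{1}iv -block_succ; apply: language_block.
have [h hP] := choice ext.
pose f (t : n.-tuple A) := [tuple of rcons t (h t)].
have f_inj : injective f.
  move=> s t /(congr1 val) /= /rcons_inj[e _]; exact: val_inj.
set Ln := [set w : n.-tuple A | `[< language u w >]].
set Ln1 := [set w : n.+1.-tuple A | `[< language u w >]].
have sub : f @: Ln \subset Ln1.
  apply/fintype.subsetP => _ /imsetP[t tL ->]; rewrite !inE in tL *.
  exact: (hP t tL).
have : #|Ln1 :\: f @: Ln| == 1.
  rewrite cardsD (finset.setIidPr sub) card_imset //.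
  by rewrite -/(factor_complexity u n) -/(factor_complexity u n.+1) pn subSnn.
case/cards1P => t0 t0E.
have diff i : u (i + n) <> h (block u i n) -> block u i n.+1 = t0.
  move=> ne; have sz : size (block u i n.+1) == n.+1 by rewrite size_block.
  suff : Tuple sz \in Ln1 :\: f @: Ln by rewrite t0E inE => /eqP <-.
  rewrite inE; apply/andP; split; last first.
    by rewrite inE; apply/asboolP; apply: language_block.
  apply/imsetP => -[t _ /(congr1 val)] /=; rewrite block_succ => /rcons_inj[e].
  by rewrite -e.
have [z zE] : exists z, val t0 = block u z n.+1.
  have : t0 \in Ln1 :\: f @: Ln by rewrite t0E inE.
  rewrite !inE => /andP[_ /asboolP /language_blockP[z]].
  by rewrite size_tuple; exists z.
exists h, z; split.
- move=> e; have : t0 \in Ln1 :\: f @: Ln by rewrite t0E inE.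
  rewrite inE => /andP[/negP[]]; apply/imsetP.
  have sz : size (block u z n) == n by rewrite size_block.
  exists (Tuple sz); first by rewrite inE; apply/asboolP; apply: language_block.
  by apply: val_inj; rewrite zE block_succ e.
- by move=> i /diff; rewrite zE => /block_sameP.
move=> i; have [j] := hP _ (language_block u i n).
rewrite /occurs_at size_rcons size_block block_succ => /rcons_inj[e1 e2].
by exists j => //; apply: same_sym; apply/block_sameP.
Qed.

Lemma unique_right_special n : recurrent u ->
  factor_complexity u n.+1 = (factor_complexity u n).+1 ->
  [/\ exists i, right_special u i n,
      forall i j, right_special u i n -> right_special u j n -> same u i j n &
      forall i j k, same u i j n -> same u i k n -> u (i + n) <> u (j + n) ->
        u (k + n) = u (i + n) \/ u (k + n) = u (j + n)].
Proof.
move=> rec pn; have [h [z [zn uniq_z hP]]] := one_extra_extension rec pn.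
have h_same i j : same u i j n -> h (block u i n) = h (block u j n).
  by move=> /block_sameP->.
have last_z i : u (i + n) <> h (block u i n) -> u (i + n) = u (z + n).
  by move=> /uniq_z S; apply: (same_at S); lia.
have special_z i : right_special u i n -> same u i z n.
  case=> j ij ne; have [e|/eqP/uniq_z S] := eqVneq (u (i + n)) (h (block u i n)).
    have /uniq_z S : u (j + n) <> h (block u j n).
      by rewrite -(h_same _ _ ij) -e => e'; apply: ne.
    by apply: (same_trans ij); apply: (same_sub S); lia.
  by apply: (same_sub S); lia.
split=> [|i j /special_z si /special_z sj|i j k ij ik ne].
- by exists z; have [j zj jn] := hP z; exists j; rewrite ?jn.
- exact: same_trans si (same_sym sj).
have := @last_z i; have := @last_z j; have := @last_z k.
rewrite -(h_same _ _ ij) -(h_same _ _ ik); set b := h _.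
have [->|/eqP kb] := eqVneq (u (k + n)) b.
  have [->|/eqP ib] := eqVneq (u (i + n)) b; first by left.
  have [->|/eqP jb] := eqVneq (u (j + n)) b; first by right.
  by move=> _ /(_ jb) ej /(_ ib) ei; case: ne; rewrite ei ej.
move=> /(_ kb) -> ej ei.
have [ib|/eqP/ei ->] := eqVneq (u (i + n)) b; last by left.
by right; rewrite ej // => jb; apply: ne; rewrite ib jb.
Qed.

End Translation.

(** * Right special palindromes as frames *)

Section Structure.
Variables (A : finType) (u : nat -> A) (N : nat).

Local Notation same := (same u).
Local Notation mirror := (mirror u).
Local Notation right_special := (right_special u).

Hypothesis recur : forall i n B, exists2 j, B <= j & same i j n.
Hypothesis rever : forall i n B, exists2 j, B <= j & mirror i j n.
Hypothesis aper :
  forall p d, 0 < d -> ~ (forall q, p <= q -> u (q + d) = u q).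
Hypothesis special_ex : forall n, N <= n -> exists i, right_special i n.
Hypothesis special_uniq : forall n i j, N <= n ->
  right_special i n -> right_special j n -> same i j n.
Hypothesis two_letters : forall n i j k, N <= n -> same i j n -> same i k n ->
  u (i + n) <> u (j + n) -> u (k + n) = u (i + n) \/ u (k + n) = u (j + n).

(** If each occurrence of a block is followed by another one at a fixed distance
    [d], and the block covers this distance, the word has period [d] from the
    first occurrence on. *)
Lemma no_shift i n d : 0 < d -> d <= n ->
  (forall q, same i q n -> same i (q + d) n) -> False.
Proof.
move=> d0 dn shift; apply: (aper (p := i) d0) => q iq.
have iter t : same i (i + t * d) n.
  elim: t => [|t IH]; first by rewrite mul0n addn0.
  by rewrite mulSnr addnA; apply: shift.
have e := divn_eq (q - i) d; have r := ltn_pmod (q - i) d0.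
set t := (q - i) %/ d in e; set z := (q - i) %% d in e r.
have -> : u q = u (i + z) by symmetry; apply: (same_at (iter t)); lia.
symmetry; apply: (same_at (iter t.+1)); rewrite ?mulSn; lia.
Qed.

(** Were no extension of the block right special, the whole right tail would be
    determined by the block, and a second occurrence would make the word
    eventually periodic. *)
Lemma right_forced i n :
  exists k, right_special i (n + k) /\
    forall j, same i j n -> same i j (n + k).
Proof.
have ext k j : (forall t, t < k -> ~ right_special i (n + t)) ->
    same i j n -> same i j (n + k).
  elim: k => [|k IH] nk S; first by rewrite addn0.
  have Sk : same i j (n + k) by apply: IH S => t tk; apply: nk; lia.
  rewrite addnS; apply: same_succ => //.
  have [//|/eqP ne] := eqVneq (u (i + (n + k))) (u (j + (n + k))).
  by case: (nk k) => //; exists j.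
have [ex|nex] := EM (exists k, right_special i (n + k)).
  have exb : exists k, `[< right_special i (n + k) >].
    by case: ex => k kP; exists k; apply/asboolP.
  case: (ex_minnP exb) => k /asboolP kP kmin; exists k; split=> // j.
  by apply: ext => t tk /asboolP /kmin; lia.
have [j ij S] := recur i n i.+1; exfalso.
apply: (aper (p := i) (d := j - i)); first lia.
move=> q iq; symmetry; have := ext (q - i).+1 j.
move=> /(_ (fun t _ h => nex (ex_intro _ t h)) S) S'.
by apply: (same_at S'); lia.
Qed.

(** The block of length [m] at [c] is a word W = y s z, where s is the block of
    length [n] at [i], |y| = [a] and |z| = [b].  The last clause says that W
    surrounds every occurrence of s that leaves room for y on its left. *)
Definition frame i n a b c m :=
  [/\ m = a + n + b, mirror c c m, right_special c m, same i (c + a) n &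
      forall j, same i (j + a) n -> same c j m].

(** Let sz be the forced extension of s to a right special word, and W the
    forced extension of the reversal of sz to a right special word.  The right
    special suffix of W of length |sz| can only be sz, so W and its reversal
    both begin with the reversal of sz, which determines them: they are
    equal. *)
Lemma frame_ex i n : N <= n -> exists a b c m, frame i n a b c m.
Proof.
move=> Nn; have [b [rsb fb]] := right_forced i n.
set M := n + b in rsb fb.
have [c _ ic] := rever i M 0.
have [a [rsa fa]] := right_forced c M.
have Sia : same i (c + a) M.
  apply: special_uniq => //; first by rewrite /M; lia.
  by apply: right_special_suffix; rewrite addnC.
(* The reversal of W occurs at j and begins with the block at c of length M. *)
have palc : mirror c c (M + a).
  have [j _ cj] := rever c (M + a) 0.
  suff Scj : same c j (M + a) by apply: mirror_same cj (same_sym Scj).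
  apply: fa; apply: (mirror_mirror (j := i)); first exact: mirror_sym.
  apply: (same_mirror Sia); apply: (mirror_sub cj); lia.
exists a, b, c, (M + a); split=> //.
- by rewrite /M; lia.
- by apply: (same_sub Sia); rewrite /M; lia.
move=> j /fb Sij.
have [j' _ jj'] := rever j (M + a) 0.
suff : same c j' (M + a).
  move=> Scj'; apply: (mirror_mirror (j := j')); last exact: mirror_sym.
  by apply: mirror_same palc Scj'.
apply: fa; apply: (mirror_mirror (j := i)); first exact: mirror_sym.
apply: (same_mirror Sij); apply: (mirror_sub jj'); lia.
Qed.

Lemma frame_rev i n a b c m j : frame i n a b c m ->
  mirror i (j + b) n -> same c j m.
Proof.
case=> em pal rs Sia f ij.
have [j' _ jj'] := rever j m 0.
suff Scj' : same c j' m.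
  apply: (mirror_mirror (j := j')); last exact: mirror_sym.
  by apply: mirror_same pal Scj'.
apply: f; apply: (mirror_mirror ij).
by apply: (mirror_sub jj'); lia.
Qed.

(** At a distance at most |z|, the word sz around the first occurrence contains
    the next s, so each W forces another W at this distance.  A distance at
    most |y| is handled in the same way with the reversal of s, which stands at
    offset |z| in the palindrome W. *)
Lemma frame_overlap i n a b c m p q : frame i n a b c m ->
  same c p m -> same c q m -> p < q -> a < q - p /\ b < q - p.
Proof.
move=> F cp cq pq; have [em pal rs Sia f] := F.
have step d : d = q - p -> d <= a \/ d <= b ->
    forall r, same c r m -> same c (r + d) m.
  move=> ed [da|db] r cr.
    apply: (frame_rev F); apply: (mirror_same (j := q + b)).
      apply: (same_mirror Sia).
      apply: (mirror_sub (mirror_same pal cq)); lia.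
    apply: (same_trans (j := c + b + d)); first by
      apply: (same_sub (same_sym cp)); lia.
    by apply: (same_sub cr); lia.
  apply: f; apply: (same_trans Sia); apply: (same_trans (j := q + a)).
    by apply: (same_sub cq); lia.
  apply: (same_trans (j := c + a + d)).
    by apply: (same_sub (same_sym cp)); lia.
  by apply: (same_sub cr); lia.
have [l|l] := ltnP a (q - p); last first.
  by case: (@no_shift c m (q - p)); [lia|lia|apply: step => //; left].
have [l'|l'] := ltnP b (q - p) => //.
by case: (@no_shift c m (q - p)); [lia|lia|apply: step => //; right].
Qed.
(** * Palindromic returns *)

Definition extension c m x y :=
  exists j, [/\ same c j.+1 m, u j = x & u (j.+1 + m) = y].

Lemma extension_left c m j : same c j m -> exists x, extension c m x (u (j + m)).
Proof.
move=> cj; have [[//|k] _ jk] := recur j m.+1 1.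
exists (u k), k; split=> //; last by symmetry; apply: (same_at jk); lia.
by apply: (same_trans cj); apply: (same_sub jk); lia.
Qed.

Lemma extension_sym c m x y :
  mirror c c m -> extension c m x y -> extension c m y x.
Proof.
move=> pal [j [cj <- <-]]; have [k _ jk] := rever j m.+2 0.
exists k; split.
- apply: (mirror_mirror pal); apply: (same_mirror cj).
  by apply: (mirror_sub jk); lia.
- by symmetry; apply: (mirror_at jk); lia.
by symmetry; apply: (mirror_at jk); lia.
Qed.

(** If x and z both precede the block and leave the choice of the next letter
    open, they begin two right special words of the same length, which are
    equal. *)
Lemma extension_uniq c m x y y' z t t' : N <= m -> y <> y' -> t <> t' ->
  extension c m x y -> extension c m x y' ->
  extension c m z t -> extension c m z t' -> x = z.
Proof.
move=> Nm.
have rs v w w' : w <> w' -> extension c m v w -> extension c m v w' ->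
    exists2 j, right_special j m.+1 & u j = v.
  move=> ne [j [cj jv jw]] [k [ck kv kw]]; exists j => //; exists k.
    case=> [|r] rm; first by rewrite !addn0 jv.
    apply: (same_at (same_trans (same_sym cj) ck)); lia.
  by rewrite !addnS -!addSn jw kw.
move=> ne ne' e1 e2 e3 e4.
have [j rsj <-] := rs _ _ _ ne e1 e2.
have [k rsk <-] := rs _ _ _ ne' e3 e4.
have S := special_uniq (leqW Nm) rsj rsk.
by apply: (same_at S); lia.
Qed.

(** The right special word of length [m.+1] ends with the one of length [m], so
    some left letter of the latter allows both right letters. *)
Lemma extension_special c m : N <= m -> right_special c m ->
  exists x y y', [/\ y <> y', extension c m x y, extension c m x y' &
    forall j, same c j m -> u (j + m) = y \/ u (j + m) = y'].
Proof.
move=> Nm rs; have [i rsi] := special_ex (leqW Nm).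
have := rsi; rewrite -[m.+1]add1n => /right_special_suffix; rewrite addn1.
move=> /(special_uniq Nm rs) ci; case: rsi => j ij ne.
have ijS : same i.+1 j.+1 m by apply: (same_sub ij); lia.
exists (u i), (u (i + m.+1)), (u (j + m.+1)); split=> //.
- by exists i; split; rewrite // addnS.
- exists j; split; [exact: same_trans ci ijS| |by rewrite addnS].
  by symmetry; apply: (same_at ij); lia.
move=> k ck; have := two_letters Nm ijS (same_trans (same_sym ci) ck).
by rewrite !addSn -!addnS; apply.
Qed.

Definition return_to c m p d :=
  [/\ 0 < d, same c p m, same c (p + d) m &
      forall t, 0 < t -> t < d -> ~ same c (p + t) m].

(** No right special word of length [m] is met strictly between the two ends of
    the return, so its first letter after the block decides all the others. *)
Lemma return_forced c m p q d : N <= m -> right_special c m ->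
  return_to c m p d -> same p q m.+1 -> same p q (d + m).
Proof.
move=> Nm rs [d0 cp cpd none] pq.
suff H t : t < d -> same p q (t + m).+1.
  by have := H d.-1; rewrite -addSn prednK //; apply; lia.
elim: t => [//|t IH] td; have S := IH (ltnW td).
apply: same_succ => //.
have St : same (p + t.+1) (q + t.+1) m by apply: (same_sub S); lia.
have [//|/eqP ne] := eqVneq (u (p + (t.+1 + m))) (u (q + (t.+1 + m))).
case: (none t.+1) => //; apply: special_uniq => //.
by exists (q + t.+1) => //; rewrite -!addnA.
Qed.

Lemma return_same c m p q d : return_to c m p d -> same p q (d + m) ->
  return_to c m q d.
Proof.
move=> [d0 cp cpd none] pq.
have sub t : t <= d -> same (p + t) (q + t) m.
  by move=> td; apply: (same_sub pq); lia.
split=> //.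
- by apply: (same_trans cp); have := sub 0; rewrite !addn0; apply.
- by apply: (same_trans cpd); apply: sub.
move=> t t0 td cq; apply: (none t) => //.
by apply: (same_trans cq); apply: same_sym; apply: sub; lia.
Qed.

Lemma return_mirror c m p q d : mirror c c m -> return_to c m p d ->
  mirror p q (d + m) -> return_to c m q d.
Proof.
move=> pal [d0 cp cpd none] pq.
have sub r s : r + s = d -> same c (p + r) m -> same c (q + s) m.
  move=> e cr; apply: (mirror_mirror pal); apply: (same_mirror cr).
  by apply: (mirror_sub pq); lia.
split=> //.
- by have := sub d 0; rewrite !addn0; apply.
- by apply: (sub 0); rewrite ?addn0.
move=> t t0 td cq; apply: (none (d - t)); [lia|lia|].
apply: (mirror_mirror pal); apply: (same_mirror cq).
by apply: (mirror_sub (mirror_sym pq)); lia.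
Qed.

(** Say that the return begins with Wa and ends with bW.  If bWb did not occur,
    each such return would be followed by Wa again, hence by a copy of itself,
    forever. *)
Lemma return_mixed c m p d : N <= m -> right_special c m -> mirror c c m ->
  return_to c m p d -> u (p + m) <> u (p + d.-1) ->
  extension c m (u (p + d.-1)) (u (p + d.-1)).
Proof.
move=> Nm rs pal R ne; have [d0 cp cpd none] := R.
set b := u (p + d.-1) in ne *.
have eS x : (x + d.-1).+1 = x + d by rewrite -addnS prednK.
have [//|nobb] := EM (extension c m b b); exfalso.
have [k [ck _ kb]] : extension c m (u (p + d + m)) b.
  by apply: extension_sym => //; exists (p + d.-1); rewrite eS.
apply: (@no_shift p (d + m) d) => // [|q pq]; first lia.
have cq : same c (q + d) m.
  by apply: (same_trans cpd); apply: (same_sub pq); lia.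
apply: return_forced R _ => //; apply: same_succ.
  exact: same_trans (same_sym cp) cq.
have [||||//|bb] := @two_letters m p k.+1 (q + d) => //.
- exact: same_trans (same_sym cp) ck.
- exact: same_trans (same_sym cp) cq.
- by rewrite kb.
case: nobb; exists (q + d.-1); rewrite eS bb; split=> //.
by symmetry; apply: (same_at pq); lia.
Qed.

Lemma return_palindrome c m p d : N <= m -> right_special c m ->
  mirror c c m -> return_to c m p d -> mirror p p (d + m).
Proof.
move=> Nm rs pal R; have [d0 cp cpd none] := R.
have [q _ pq] := rever p (d + m) 0.
have R' := return_mirror pal R pq; have [_ cq _ _] := R'.
have eq1 : u (q + m) = u (p + d.-1).
  by apply: (mirror_at (mirror_sym pq)); lia.
have eq2 : u (q + d.-1) = u (p + m).
  by apply: (mirror_at (mirror_sym pq)); lia.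
have [e|/eqP ne] := eqVneq (u (p + m)) (u (p + d.-1)).
  apply: (mirror_same pq); apply: same_sym; apply: return_forced R _ => //.
  by apply: same_succ; [exact: same_trans (same_sym cp) cq|rewrite e eq1].
have bb := return_mixed Nm rs pal R ne.
have aa : extension c m (u (p + m)) (u (p + m)).
  have := return_mixed Nm rs pal R'; rewrite eq1 eq2; apply.
  by move=> e; apply: ne.
have [x [y [y' [yy' xy xy' letters]]]] := extension_special Nm rs.
have right z t : extension c m z t -> t = y \/ t = y'.
  by case=> j [cj _ <-]; apply: letters.
have xe z : extension c m z z -> extension c m x z.
  by move=> /right[->|->].
have impossible a b : a <> b -> extension c m a a -> extension c m b b ->
    x = a -> False.
  move=> ab ea eb xa; subst x; apply: (ab).
  apply: (extension_uniq Nm yy' ab xy xy' _ eb).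
  exact: extension_sym (xe _ eb).
have [xa|xb] : x = u (p + m) \/ x = u (p + d.-1).
- have := right _ _ (extension_sym pal xy).
  have := right _ _ aa; have := right _ _ bb.
  by move=> [] e1 [] e2 [] ->; rewrite e1 e2 in ne *; auto; case: ne.
- by case: (impossible _ _ ne aa bb xa).
by case: (impossible _ _ (nesym ne) bb aa xb).
Qed.

(** If v is right special, let x be the left letter compatible with both right
    letters; x is also a right letter, so x v x occurs.  If z v z occurred for
    the other letter z, then z v x, the reversal of x v z, would make z as
    flexible as x.  If v is not right special, its right letter is forced, and
    so is its left letter, by reversal. *)
Lemma palindromic_extension c m : N <= m -> mirror c c m ->
  exists x, extension c m x x /\ forall z, extension c m z z -> z = x.
Proof.
move=> Nm pal; have [rs|nrs] := EM (right_special c m).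
  have [x [y [y' [yy' xy xy' letters]]]] := extension_special Nm rs.
  have right z t : extension c m z t -> t = y \/ t = y'.
    by case=> j [cj _ <-]; apply: letters.
  exists x; have xx : extension c m x x.
    by have [e|e] := right _ _ (extension_sym pal xy); rewrite {2}e.
  split=> // z zz; have [//|/eqP zx] := eqVneq z x.
  have xz : extension c m x z by have [e|e] := right _ _ zz; rewrite e.
  symmetry; apply: (extension_uniq Nm yy' zx xy xy' zz).
  exact: extension_sym.
have right z t : extension c m z t -> t = u (c + m).
  case=> j [cj _ <-]; have [//|/eqP ne] := eqVneq (u (j.+1 + m)) (u (c + m)).
  by case: nrs; exists j.+1 => // e; apply: ne.
have [x xc] := extension_left (@same_refl _ u c m).
exists (u (c + m)); split=> [|z /right //].
by have := right _ _ (extension_sym pal xc) => {1}<-.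
Qed.

(** With W = y s z the frame of s, the occurrences of s and of its reversal are
    those at offsets |y| and |z| in the occurrences of W.  Since W does not
    overlap itself too much, consecutive ones are placed symmetrically either in
    a single W or in a palindromic return of W. *)
Lemma twin_return_framed s n a b c m i j : N <= n -> frame s n a b c m ->
  a + b <= i -> i < j -> same s i n -> same s j n \/ mirror s j n ->
  (forall q, i < q -> q < j -> ~ same s q n /\ ~ mirror s q n) ->
  mirror i i (j - i + n).
Proof.
move=> Nn F abi ij si sj none; have [em pal rs sc f] := F.
have at_a r : same c r m -> same s (r + a) n.
  by move=> cr; apply: (same_trans sc); apply: (same_sub cr); lia.
have at_b r : same c r m -> mirror s (r + b) n.
  move=> cr; apply: (same_mirror sc).
  by apply: (mirror_sub (mirror_same pal cr)); lia.
have ci : same c (i - a) m by apply: f; rewrite subnK //; lia.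
(* Each W also carries the reversal of s.  If both ends of the interval carry s
   itself, the reversals in the two copies of W are kept out of the interval
   only if they coincide with s. *)
have {}sj : mirror s j n.
  case: sj => // sj.
  have cj : same c (j - a) m by apply: f; rewrite subnK //; lia.
  have [|la lb] := frame_overlap F ci cj; first lia.
  have [lt|le] := ltnP i (i - a + b).
    by have [|n1 n2] := none _ lt; [lia|case: n2; apply: at_b].
  have [e|ne] := eqVneq (j - a + b) j; first by rewrite -e; apply: at_b.
  by have [||n1 n2] := none (j - a + b); [lia|lia|case: n2; apply: at_b].
have cj : same c (j - b) m by apply: (frame_rev F); rewrite subnK //; lia.
have [lt|gt|e] := ltngtP (i - a) (j - b).
- have R : return_to c m (i - a) (j - b - (i - a)).
    split=> //; [lia|by rewrite subnKC // ltnW|].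
    move=> t t0 td ct.
    have [|la lb] := frame_overlap F ci ct; first lia.
    have [l|l] := ltnP (i - a + t + a) j.
      by have [||n1 n2] := none (i - a + t + a); [lia|lia|case: n1; apply: at_a].
    by have [||n1 n2] := none (i - a + t + b); [lia|lia|case: n2; apply: at_b].
  have pali := return_palindrome (m := m) _ rs pal R.
  by apply: (mirror_sub (pali _)); lia.
- have [//|la lb] := frame_overlap F cj ci; lia.
apply: (mirror_sub (same_mirror (same_sym ci) (mirror_same pal ci))); lia.
Qed.

(** Recurrence moves the configuration far enough to the right for the frame of
    the first block to fit. *)
Lemma twin_return n i j : N <= n -> i < j ->
  same i j n \/ mirror i j n ->
  (forall q, i < q -> q < j -> ~ same i q n /\ ~ mirror i q n) ->
  mirror i i (j - i + n).
Proof.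
move=> Nn ij twin none; have [a [b [c [m F]]]] := frame_ex i Nn.
have [k abk ik] := recur i (j - i + n) (a + b).
have sub q r : i <= q -> q <= j -> q + k = r + i -> same q r n.
  by move=> iq qj e; apply: (same_sub ik); lia.
have := @twin_return_framed i n a b c m k (k + (j - i)) Nn F abk.
have -> : k + (j - i) - k = j - i by lia.
move=> H; apply: (same_mirror ik).
apply: (mirror_same _ (same_sym ik)); apply: H; first lia.
- by apply: sub; lia.
- have jk : same j (k + (j - i)) n by apply: sub; lia.
  case: twin => S; [left; exact: same_trans S jk|].
  by right; exact: mirror_same S jk.
move=> q kq qj; have [||ns nm] := none (q + i - k); [lia|lia|].
have qk : same (q + i - k) q n by apply: sub; lia.
split=> S; [apply: ns|apply: nm].
  exact: same_trans S (same_sym qk).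
exact: mirror_same S (same_sym qk).
Qed.
(** * Counting palindromes *)

(** Uniqueness of palindromic extensions, applied [s] times starting from the
    common center. *)
Lemma central_same s p q k : N <= k -> mirror p p (k + s.*2) ->
  mirror q q (k + s.*2) -> same (p + s) (q + s) k -> same p q (k + s.*2).
Proof.
move=> Nk; elim: s p q => [|s IH] p q palp palq S.
  by rewrite !addn0 in S *.
have inner r : mirror r r (k + s.+1.*2) -> mirror r.+1 r.+1 (k + s.*2).
  by move=> palr; apply: (mirror_sub palr); lia.
have ends r : mirror r r (k + s.+1.*2) -> u (r.+1 + (k + s.*2)) = u r.
  by move=> palr; apply: (mirror_at palr); lia.
have {}S : same p.+1 q.+1 (k + s.*2).
  by apply: IH; rewrite ?addSn -?addnS; auto.
have [|x [_ x_uniq]] := @palindromic_extension p.+1 (k + s.*2) _ (inner _ palp).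
  lia.
have up : u p = x by apply: x_uniq; exists p; split; auto.
have uq : u q = x by apply: x_uniq; exists q; split; auto.
move=> [|t] tk; first by rewrite !addn0 up uq.
have [e|ne] := eqVneq t (k + s.*2); last by apply: (same_at S); lia.
by rewrite !addnS -!addSn e !ends // up uq.
Qed.

Lemma palindrome_grow q k t : N <= k -> mirror q q k ->
  exists2 p, mirror p p (k + t.*2) & same q (p + t) k.
Proof.
move=> Nk palq; elim: t => [|t [p palp qp]]; first by exists q; rewrite !addn0.
have [|x [[j [pj jx xj]] _]] := @palindromic_extension p (k + t.*2) _ palp.
  lia.
exists j => [r rk|]; last first.
  by apply: (same_trans qp); apply: (same_sub pj); lia.
have [->|r0] := eqVneq r 0; first by rewrite addn0 jx -xj; congr u; lia.
have [->|rm] := eqVneq r (k + t.*2).+1.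
  have -> : j + (k + t.+1.*2 - (k + t.*2).+2) = j by lia.
  by rewrite jx -xj; congr u; lia.
have palj := same_mirror (same_sym pj) (mirror_same palp pj).
by apply: (mirror_at palj); lia.
Qed.

(** A palindrome s stands at offsets |y| and |z| of its frame; if these differed,
    there would be two occurrences of the frame at distance ||y| - |z||. *)
Lemma frame_center i n a b c m : N <= n -> frame i n a b c m ->
  mirror i i n -> a = b.
Proof.
move=> Nn F pali; have [em pal rs ic f] := F.
have [r abr cr] := recur c m (a + b).
have ir : same i (r + a) n.
  by apply: (same_trans ic); apply: (same_sub cr); lia.
have cr' : same c (r + a - b) m.
  apply: (frame_rev F); rewrite subnK; last lia.
  exact: mirror_same pali ir.
have [l|l|//] := ltngtP a b.
  by have [|] := frame_overlap F cr' cr; lia.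
by have [|] := frame_overlap F cr cr'; lia.
Qed.

(** Growing the palindrome beyond length [m] first ensures that the right special
    palindrome obtained as its frame is long enough to contain the one of
    length [m] as a suffix. *)
Lemma palindrome_in_special m q k : N <= k -> mirror q q k ->
  exists g s, [/\ m <= k + s.*2, right_special g (k + s.*2),
    mirror g g (k + s.*2) & same q (g + s) k].
Proof.
move=> Nk palq; have [p palp qp] := palindrome_grow m Nk palq.
have NK : N <= k + m.*2 by lia.
have [a [b [c [M F]]]] := frame_ex p NK.
have ab := frame_center NK F palp; have [em pal rs pc _] := F.
have e : k + (m + a).*2 = M by lia.
exists c, (m + a); rewrite e; split=> //; first lia.
by apply: (same_trans qp); apply: (same_sub pc); lia.
Qed.

Lemma next_return c m p : same c p m -> exists d, return_to c m p d.
Proof.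
move=> cp; have [j pj cj] := recur c m p.+1.
have ex : exists d, (0 < d) && `[< same c (p + d) m >].
  exists (j - p); apply/andP; split; first lia.
  by apply/asboolP; rewrite subnKC // ltnW.
case: (ex_minnP ex) => d /andP[d0 /asboolP cd] dmin; exists d; split=> // t t0 td.
move=> ct; have := dmin t; rewrite t0; move/asboolP: ct => -> /(_ isT).
by rewrite leqNgt td.
Qed.

Lemma return_uniq c m p d e : return_to c m p d -> return_to c m p e -> d = e.
Proof.
move=> [d0 _ cd nd] [e0 _ ce ne].
by have [l|l|//] := ltngtP d e; [case: (ne d)|case: (nd e)].
Qed.

(** For the right special palindrome W of length [m] at [c], a core is either W
    itself or a palindromic return of W. *)
Definition core c m p l :=
  [/\ mirror p p l, same c p m, m <= l &
      forall t, 0 < t -> t < l - m -> ~ same c (p + t) m].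

(** If the trimmed palindromes agree, the shorter core stands at the center of
    the longer one, which puts an occurrence of W strictly inside it. *)
Lemma core_eq c m p q k s t : N <= k -> s <= t ->
  core c m p (k + s.*2) -> core c m q (k + t.*2) ->
  same (p + s) (q + t) k -> s = t /\ same p q (k + s.*2).
Proof.
move=> Nk st [palp cp ml np] [palq cq ml' nq] pq.
have S : same p (q + (t - s)) (k + s.*2).
  apply: central_same => //; last by have -> : q + (t - s) + s = q + t by lia.
  by apply: (mirror_sub palq); lia.
have [e|ne] := eqVneq s t; first by move: S; rewrite e subnn addn0.
case: (nq (t - s)); [lia|lia|].
by apply: (same_trans cp); apply: (same_sub S); lia.
Qed.

(** Inside a large right special palindrome that begins and ends with W, the
    occurrence of W closest to the center from the left and its mirror image
    delimit a core. *)
Lemma core_around c m q k : N <= k -> k <= m -> right_special c m ->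
  mirror c c m -> mirror q q k ->
  exists p s, core c m p (k + s.*2) /\ same q (p + s) k.
Proof.
move=> Nk km rs pal palq.
have [g [S [mM rsg palg qg]]] := palindrome_in_special m Nk palq.
set M := k + S.*2 in mM rsg palg.
have flip o : o + m <= M -> same c (g + o) m -> same c (g + (M - m - o)) m.
  move=> oM co; apply: (mirror_mirror pal); apply: (same_mirror co).
  by apply: (mirror_sub palg); lia.
have cg : same c g m.
  have -> : g = g + (M - m - (M - m)) by lia.
  apply: flip; first lia.
  apply: special_uniq => //; first lia.
  by apply: right_special_suffix; rewrite subnK.
have ex : exists o, (o.*2 + m <= M) && `[< same c (g + o) m >].
  by exists 0; apply/andP; split; [lia|apply/asboolP; rewrite addn0].
have bound o : (o.*2 + m <= M) && `[< same c (g + o) m >] -> o <= M.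
  by case/andP; lia.
case: (ex_maxnP ex bound) => o /andP[oM /asboolP co] omax.
have {}omax t : o < t -> t.*2 + m <= M -> ~ same c (g + t) m.
  move=> ot tM ct; have := omax t; rewrite tM.
  by move/asboolP: ct => -> /(_ isT); rewrite leqNgt ot.
have os : k + (S - o).*2 = M - o.*2 by rewrite /M in oM *; lia.
have oS : o <= S by rewrite /M in oM; lia.
exists (g + o), (S - o); rewrite os; split; last first.
  by have -> : g + o + (S - o) = g + S by lia.
split=> //; [by apply: (mirror_sub palg); lia|lia|].
move=> t t0 tM ct; rewrite -addnA in ct.
have [l|l] := leqP ((o + t).*2 + m) M.
  by case: (omax (o + t)) => //; lia.
by case: (omax (M - m - (o + t))); [lia|lia|apply: flip => //; lia].
Qed.

Section ThreeCores.
Variables (c c' m d d' : nat).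
Hypotheses (Nm : N <= m) (pal : mirror c c m).
Hypotheses (cc' : same c c' m) (letters : u (c + m) <> u (c' + m)).
Hypotheses (ret : return_to c m c d) (ret' : return_to c m c' d').

Let rs : right_special c m.
Proof. by exists c'. Qed.

Definition cores := [:: (c, m); (c, d + m); (c', d' + m)].

Lemma core_return p e : return_to c m p e -> core c m p (e + m).
Proof.
move=> R; split; [exact: return_palindrome R|by case: R|lia|].
by rewrite addnK; case: R.
Qed.

Lemma coresP e : e \in cores -> core c m e.1 e.2.
Proof.
rewrite !inE => /or3P[]/eqP-> /=; try exact: core_return.
by split=> //; rewrite subnn.
Qed.

Lemma core_in_cores p l : core c m p l ->
  exists2 e, e \in cores & e.2 = l /\ same e.1 p l.
Proof.
move=> [palp cp ml none]; have [e|ne] := eqVneq l m.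
  by exists (c, m); rewrite ?inE ?eqxx //= e.
have R : return_to c m p (l - m).
  split=> //; first lia.
  apply: (mirror_mirror pal); apply: (same_mirror cp).
  by apply: (mirror_sub palp); lia.
have follow q e : same c q m -> return_to c m q e -> u (p + m) = u (q + m) ->
    e + m = l /\ same q p l.
  move=> cq Rq uq; have qp : same q p m.+1.
    by apply: same_succ => //; apply: same_trans (same_sym cq) cp.
  have S := return_forced Nm rs Rq qp.
  have el := return_uniq (return_same Rq S) R.
  have el' : e + m = l by lia.
  by split; rewrite -?el'.
have [up|up] := two_letters Nm cc' cp letters.
  exists (c, d + m); first by rewrite !inE eqxx orbT.
  exact: follow (@same_refl _ u c m) ret up.
exists (c', d' + m); first by rewrite !inE eqxx !orbT.
exact: follow cc' ret' up.
Qed.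

Lemma cores_inj e f : e \in cores -> f \in cores -> e.2 = f.2 ->
  same e.1 f.1 e.2 -> e = f.
Proof.
have [d0 _ _ _] := ret; have [d0' _ _ _] := ret'.
rewrite !inE => /or3P[]/eqP-> /or3P[]/eqP-> //= ed S; try lia.
  by case: letters; apply: (same_at S); lia.
by case: letters; symmetry; apply: (same_at S); lia.
Qed.

Lemma uniq_cores : uniq cores.
Proof.
have [d0 _ _ _] := ret; have [d0' _ _ _] := ret'.
have cN : (c == c') = false by apply/eqP => e; case: letters; rewrite e.
have ltN x : 0 < x -> (m == x + m) = false by lia.
by rewrite /cores /= !inE !xpair_eqE cN !ltN ?andbF.
Qed.

(** Trimming a core of the right parity to its central block of length [k] is a
    bijection onto the palindromes of length [k]. *)
Lemma palindromic_complexity_cores k : N <= k -> k <= m ->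
  palindromic_complexity u k =
  size [seq e <- cores | odd e.2 == odd k].
Proof.
move=> Nk km; set E := (X in size X).
pose mid (e : nat * nat) := block u (e.1 + (e.2 - k)./2) k.
have EP e : e \in E -> e \in cores /\ exists s, e.2 = k + s.*2.
  rewrite mem_filter => /andP[par eE]; split=> //.
  have [_ _ ml _] := coresP eE; exists (e.2 - k)./2.
  have ke : k <= e.2 by apply: leq_trans ml.
  have := odd_double_half (e.2 - k); rewrite oddB // (eqP par) addbb.
  by lia.
have half s : (k + s.*2 - k)./2 = s by lia.
have uniq_mid : uniq [seq mid e | e <- E].
  rewrite map_inj_in_uniq ?filter_uniq ?uniq_cores // => e f.
  move=> /EP[eE [s es]] /EP[fE [t ft]]; rewrite /mid => /block_sameP.
  rewrite es ft !half => S.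
  have ce := coresP eE; have cf := coresP fE; rewrite es in ce; rewrite ft in cf.
  apply: cores_inj; rewrite ?es ?ft //.
    have [st|ts] := leqP s t; first by have [-> ] := core_eq Nk st ce cf S.
    by have [-> ] := core_eq Nk (ltnW ts) cf ce (same_sym S).
  have [st|ts] := leqP s t; first by have [] := core_eq Nk st ce cf S.
  have [<- /same_sym] := core_eq Nk (ltnW ts) cf ce (same_sym S).
  by [].
rewrite /palindromic_complexity cardE -(size_map val) -(size_map mid E).
apply: perm_size; apply: uniq_perm => //.
  by rewrite map_inj_uniq ?enum_uniq //; apply: val_inj.
move=> w; apply/mapP/mapP => [[v]|[[x l] eE ->]].
  rewrite mem_enum inE => /andP[/asboolP /language_blockP[i]].
  rewrite size_tuple => vi; rewrite vi => /block_palindrome pali ->.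
  have [p [s [cps ip]]] := core_around Nk km rs pal pali.
  have [[x l] eE /= [el ep]] := core_in_cores cps.
  exists (x, l); first by rewrite mem_filter eE /= el oddD odd_double addbF eqxx.
  rewrite [LHS]vi /mid /= el half; apply/block_sameP.
  by apply: (same_trans ip); apply: (same_sub (same_sym ep)); lia.
have [/coresP[/= pale _ _ _] [s /= es]] := EP _ eE.
have sz : size (mid (x, l)) == k by rewrite size_block.
exists (Tuple sz) => //; rewrite mem_enum inE /=; apply/andP; split.
  by apply/asboolP; apply: language_block.
rewrite es in pale *; apply/block_palindrome => /=; rewrite half.
by apply: (mirror_sub pale); lia.
Qed.

End ThreeCores.

(** Each of the three cores has the parity of exactly one of [k] and [k.+1]. *)
Lemma palindromic_complexity_pair k : N <= k ->
  palindromic_complexity u k + palindromic_complexity u k.+1 = 3.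
Proof.
move=> Nk; have [a [b [c [m [em pal [c' cc' ne] _ _]]]]] := frame_ex 0 (leqW Nk).
have Nm : N <= m by lia.
have [d ret] := next_return (@same_refl _ u c m).
have [d' ret'] := next_return cc'.
rewrite (palindromic_complexity_cores Nm pal cc' ne ret ret' Nk); last lia.
rewrite (palindromic_complexity_cores Nm pal cc' ne ret ret' (leqW Nk)); last lia.
rewrite /cores /=.
by case: (odd m); case: (odd (d + m)); case: (odd (d' + m)); case: (odd k).
Qed.

(** * Bounding the defect *)

(** Take for [q] the last position before [j] carrying the block or its
    reversal. *)
Lemma repeat_palindrome n i j : N <= n -> i < j -> same i j n ->
  exists q, [/\ i <= q, q < j & mirror q q (j - q + n)].
Proof.
move=> Nn ij S.
pose twin q := `[< same q j n \/ mirror q j n >].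
have ex : exists q, (i <= q < j) && twin q.
  by exists i; rewrite leqnn ij; apply/asboolP; left.
have bound q : (i <= q < j) && twin q -> q <= j by lia.
case: (ex_maxnP ex bound) => q /andP[/andP[iq qj] /asboolP tq] qmax.
exists q; split=> //; apply: twin_return => // r qr rj.
have ntr : ~ (same r j n \/ mirror r j n).
  move=> /asboolP tr; have := qmax r.
  rewrite /twin tr rj andbT (leq_trans iq (ltnW qr)).
  by move=> /(_ isT); rewrite leqNgt qr.
split=> Sr; apply: ntr; case: tq => tq.
- by left; apply: same_trans (same_sym Sr) tq.
- by right; apply: same_mirror (same_sym Sr) tq.
- by right; apply: mirror_same (mirror_sym Sr) tq.
- by left; apply: mirror_mirror (mirror_sym Sr) tq.
Qed.

Lemma longest_palindromic_suffix p j : exists l,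
  [/\ l <= j, mirror (p + (j - l)) (p + (j - l)) l &
      forall l', l' <= j -> mirror (p + (j - l')) (p + (j - l')) l' -> l' <= l].
Proof.
pose P l := (l <= j) && `[< mirror (p + (j - l)) (p + (j - l)) l >].
have ex : exists l, P l by exists 0; rewrite /P leq0n; apply/asboolP.
have bound l : P l -> l <= j by case/andP.
case: (ex_maxnP ex bound) => l /andP[lj /asboolP pl] lmax; exists l; split=> //.
by move=> l' lj' /asboolP pl'; apply: lmax; rewrite /P lj' pl'.
Qed.

(** Send each prefix of w whose longest palindromic suffix has length at least N
    to that suffix, and each other prefix to its length if this is less than N,
    and to its suffix of length N otherwise.  Both maps are injective: a
    repetition would yield a longer palindromic suffix. *)
Lemma word_defect_bound w : language u w ->
  (word_defect w <= (N + #|A| ^ N)%N%:Z)%R.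
Proof.
move=> /language_blockP[p]; set L := size w => wE.
have [lps lpsP] := choice (longest_palindromic_suffix p).
have lps_new j o n : N <= n -> lps j <= n -> n <= j -> o < j - n ->
    ~ same (p + o) (p + (j - n)) n.
  move=> Nn ln nj on S; have [|q [oq qj palq]] := repeat_palindrome Nn _ S.
    lia.
  have [_ _ lmax] := lpsP j; have := lmax (j - (q - p)).
  have -> : p + (j - (j - (q - p))) = q by lia.
  have -> : j - (q - p) = p + (j - n) - q + n by lia.
  by move=> /(_ _ palq); lia.
pose good := [set j : 'I_L.+1 | N <= lps j].
pose pals := [set v : L.-bseq A | infix v w && palindrome v].
pose last_pal (j : 'I_L.+1) : L.-bseq A :=
  insub_bseq L (block u (p + (j - lps j)) (lps j)).
have last_palE j : last_pal j = block u (p + (j - lps j)) (lps j) :> seq A.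
  rewrite /last_pal /insub_bseq insubdK // -topredE /= size_block.
  by have [lj _ _] := lpsP j; apply: leq_trans lj _; rewrite -ltnS.
have good_le : #|good| <= #|pals|.
  have inj : {in good &, injective last_pal}.
    move=> i j; rewrite !inE => gi gj e.
    have {}e : block u (p + (i - lps i)) (lps i)
               = block u (p + (j - lps j)) (lps j) by rewrite -!last_palE e.
    have el : lps i = lps j by have := congr1 size e; rewrite !size_block.
    rewrite el in e gi; move/block_sameP: e => S.
    have [li _ _] := lpsP i; have [lj _ _] := lpsP j; rewrite el in li.
    apply: val_inj => /=; have [ij|ij|//] := ltngtP i j.
      by case: (@lps_new j (i - lps j) (lps j)) => //; lia.
    case: (@lps_new i (j - lps j) (lps j)); rewrite ?el //; first lia.
    exact: same_sym.
  rewrite -(card_in_imset inj); apply: subset_leq_card.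
  apply/fintype.subsetP => _ /imsetP[j jg ->]; rewrite inE last_palE.
  have [lj pj _] := lpsP j; apply/andP; split; last exact/block_palindrome.
  apply/infixP; exists (block u p (j - lps j)), (block u (p + j) (L - j)).
  rewrite [LHS]wE /block -!map_cat; congr map.
  have jL : j <= L by rewrite -ltnS.
  rewrite -{1}(subnKC jL) iotaD -{1}(subnK lj) iotaD -catA //.
have bad_le : #|~: good| <= N + #|A| ^ N.
  pose code (j : 'I_L.+1) : 'I_N + N.-tuple A :=
    if insub (j : nat) is Some i then inl i
    else inr [tuple u (p + (j - N) + i) | i < N].
  have inj : {in ~: good &, injective code}.
    move=> i j; rewrite !inE -!ltnNge /code => bi bj.
    case: insubP => [i' _ ei|Ni]; case: insubP => [j' _ ej|Nj] // [e].
      by apply: val_inj; rewrite /= -ei -ej e.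
    rewrite -leqNgt in Ni; rewrite -leqNgt in Nj.
    have S : same (p + (i - N)) (p + (j - N)) N.
      by move=> k kN; have /eq_in_map/(_ (Ordinal kN) (mem_enum _ _)) := e.
    apply: val_inj => /=; have [ij|ij|//] := ltngtP i j.
      by case: (@lps_new j (i - N) N) => //; lia.
    by case: (@lps_new i (j - N) N) => //; [lia|lia|exact: same_sym].
  rewrite -(card_in_imset inj); apply: leq_trans (max_card _) _.
  by rewrite card_sum card_ord card_tuple.
have := cardsC good; rewrite card_ord => cards.
rewrite /word_defect -/L -/pals; lia.
Qed.

End Structure.

Theorem corollary5p1 (R : realType) (A : finType) (u : nat -> A)
    (u_recurrent : recurrent u) (u_aperiodic : aperiodic u)
    (u_quasi_sturmian : quasi_sturmian u)
    (u_reversal : closed_under_reversal u) :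
  (exists N : nat, forall n : nat, N <= n ->
     palindromic_complexity u n + palindromic_complexity u n.+1 = 3) /\
  (defect R u < +oo)%E.
Proof.
have [_ [d [N pN]]] := u_quasi_sturmian.
have recur := recurrent_same u_recurrent.
have rever := reversal_mirror u_recurrent u_reversal.
have aper := aperiodic_shift u_aperiodic.
have pS n : N <= n -> factor_complexity u n.+1 = (factor_complexity u n).+1.
  by move=> Nn; have := pN n Nn; have := pN n.+1 (leqW Nn); lia.
have special n (Nn : N <= n) :=
  @unique_right_special A u n u_recurrent (pS n Nn).
have ex n (Nn : N <= n) : exists i, right_special u i n by case: (special n Nn).
have uniq_s n i j (Nn : N <= n) :
    right_special u i n -> right_special u j n -> same u i j n.
  by have [_ + _] := special n Nn; apply.
have two n i j k (Nn : N <= n) : same u i j n -> same u i k n ->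
    u (i + n) <> u (j + n) -> u (k + n) = u (i + n) \/ u (k + n) = u (j + n).
  by have [_ _] := special n Nn; apply.
split; first by exists N => n; apply: palindromic_complexity_pair.
apply: (@le_lt_trans _ _ ((N + #|A| ^ N)%N%:R%:E)%E); last exact: ltry.
apply: ge_ereal_sup => _ [w wL <-].
have wN := word_defect_bound recur rever aper ex uniq_s two wL.
by rewrite lee_fin -[leRHS]mulrz_nat ler_int natz.
Qed.
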